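(* Let $R\ge 1$, let $0<b_1<b_2<\cdots<b_R$ be positive integers, and let $A_{\nu_1},\dots,A_{\nu_R}$ be independent Poisson random variables with means $\nu_1,\dots,\nu_R>0$. Put $S=\sum_{r=1}^R b_rA_{\nu_r}$, $\mu=E[S]=\sum_{r=1}^R b_r\nu_r$, $\sigma^2=\mathrm{Var}(S)=\sum_{r=1}^R b_r^2\nu_r$, $\beta=\mu/\sigma^2$, $\lambda=\beta\mu$ and $\delta_r=b_r\nu_r/\mu$ for $r=1,\dots,R$. Assume that $\lambda\ge 1$ and that $\beta$ is rational, $\beta=n/m$ with $n,m$ relatively prime positive integers. Then for all integers $y>\lambda+1$, $$\left|\frac{P(\beta S\ge y)}{P(A_\lambda\ge y)}-1\right|\le (1+\alpha^* )\,\mathfrak{C}_+(y;\lambda)+(1+\alpha^* )\,\mathfrak{C}_-(y;\lambda)+\alpha^*,$$ where $$\mathfrak{C}_+(y;\lambda)=\frac{\lambda+1}{y\,\pi_{y-1}},\qquad \mathfrak{C}_-(y;\lambda)=\frac{2\lambda}{\min\{\pi_0,\lfloor\lambda\rfloor\pi_{y-1}\}},$$ and $$\alpha^*=\sum_{r=r^*+1}^R(\lceil\beta b_r\rceil-2)\,\delta_r,\qquad r^*=\max\{r\in\{1,\dots,R\}:\beta b_r\le 1\}.$$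
   Context: $A_\lambda$ denotes a Poisson random variable with mean $\lambda$, and $\pi_k=P(A_\lambda=k)=e^{-\lambda}\lambda^k/k!$ for $k=0,1,2,\dots$. *)

(* Defs.v *)
From HB Require Import structures.
From mathcomp Require Import all_boot all_order all_algebra.
From mathcomp Require Import all_classical all_reals all_analysis.

Set Implicit Arguments.
Unset Strict Implicit.
Unset Printing Implicit Defensive.

Import Order.TTheory GRing.Theory Num.Theory.
Import numFieldNormedType.Exports.

Local Open Scope classical_set_scope.
Local Open Scope ring_scope.

(* [poisson_prob] takes a second argument, of type [nat], that it ignores. *)
Definition poisson_law (R : realType) (rate : R) : set nat -> \bar R :=
  poisson_prob rate 0.

Definition mutually_independent (R : realType) (d d' : measure_display)
    (T : measurableType d) (T' : measurableType d') (P : probability T R)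
    (I : finType) (X : I -> {RV P >-> T'}) : Prop :=
  forall (J : {set I}) (B : I -> set T'),
    (forall i, i \in J -> measurable (B i)) ->
    P (\bigcap_(i in [set` J]) (X i @^-1` B i)) =
    (\prod_(i in J) P (X i @^-1` B i))%E.

(* The indices 1, ..., K of the mathematics are the ordinals 0, ..., K - 1. *)

Definition weighted_sum (R : realType) (d : measure_display)
    (T : measurableType d) (P : probability T R) (K : nat)
    (b : 'I_K -> nat) (A : 'I_K -> {RV P >-> nat}) : T -> R :=
  fun w => \sum_(r < K) (b r)%:R * (A r w)%:R.

Section parameters.
Context (R : realType) (K : nat) (b : 'I_K -> nat) (nu : 'I_K -> R).

Definition mu : R := \sum_(r < K) (b r)%:R * nu r.

Definition sigma2 : R := \sum_(r < K) (b r)%:R ^+ 2 * nu r.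

Definition beta : R := mu / sigma2.

Definition lambda : R := beta * mu.

Definition delta (r : 'I_K) : R := (b r)%:R * nu r / mu.

(* 1-based: the ordinal [r] stands for the index [r.+1].  The maximum is 0 on
   an empty range, which does not occur for positive [b] and [nu], since then
   [beta * b_1 <= 1]. *)
Definition rstar : nat := \max_(r < K | beta * (b r)%:R <= 1) r.+1.

Definition alphastar : R :=
  \sum_(r < K | (rstar < r.+1)%N)
    ((Num.ceil (beta * (b r)%:R))%:~R - 2) * delta r.

End parameters.

(* In the next two definitions [poisson_pmf lam k] is
   [exp (- lam) * lam ^ k / k!] only when [0 < lam]. *)

Definition Cplus (R : realType) (y : nat) (lam : R) : R :=
  (lam + 1) / (y%:R * poisson_pmf lam y.-1).

Definition Cminus (R : realType) (y : nat) (lam : R) : R :=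
  2 * lam / Num.min (poisson_pmf lam 0)
                    ((Num.floor lam)%:~R * poisson_pmf lam y.-1).

(* Main.v *)
(* Markov's inequality already gives the bound.  Since [beta * S] has mean
   [lambda], [P(beta S >= y) <= lambda / y], whereas
   [P(A_lambda >= y) >= pi_y = lambda * pi_(y-1) / y]; the ratio therefore lies
   between [0] and [1 / pi_(y-1)].  On the other side [floor lambda <= lambda]
   yields [C_-(y; lambda) >= 2 / pi_(y-1)], and [alpha* >= 0].  The mean and
   the variance of [S] come from the identity
   [E(A * h(A)) = nu * E(h(A + 1))] for a Poisson variable [A] of mean [nu],
   together with pairwise independence. *)

Require Import Defs.
From HB Require Import structures.
From mathcomp Require Import all_boot all_order all_algebra.
From mathcomp Require Import all_classical all_reals all_analysis.
From mathcomp Require Import measurable_realfun.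
From mathcomp Require Import ring lra.

Set Implicit Arguments.
Unset Strict Implicit.
Unset Printing Implicit Defensive.

Import Order.TTheory GRing.Theory Num.Theory.
Import numFieldNormedType.Exports.

Local Open Scope classical_set_scope.
Local Open Scope ring_scope.

(** * Integration of functions of random variables with values in [nat] *)

Section nat_valued.
Context (d : measure_display) (T : measurableType d) (R : realType).
Implicit Types (P : probability T R) (f : nat -> R).
Local Open Scope ereal_scope.

Lemma measurable_natfun P (X : {RV P >-> nat}) (D : set T) f :
  measurable_fun D (EFin \o (fun w => f (X w))).
Proof.
apply/measurable_EFinP; apply: measurable_funTS.
by apply: (measurableT_comp (f := f)).
Qed.

Lemma measurable_preimage_nat P (X : {RV P >-> nat}) (U : set nat) :
  measurable (X @^-1` U).
Proof. by rewrite -[X in measurable X]setTI; exact: measurable_funP. Qed.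

(** The fibres of [X] form a countable measurable partition of the whole space. *)
Lemma ge0_integral_fibers P (X : {RV P >-> nat}) (g : T -> \bar R) :
  (forall w, 0 <= g w) -> measurable_fun setT g ->
  \int[P]_w g w = \sum_(k <oo) \int[P]_(w in X @^-1` [set k]) g w.
Proof.
move=> g0 mg; have XT : \bigcup_k (X @^-1` [set k]) = setT.
  by apply/seteqP; split => // w _; exists (X w).
rewrite -XT ge0_integral_bigcup ?XT//.
- by move=> k; exact: measurable_preimage_nat.
- apply/trivIsetP => i j _ _ ij; rewrite -subset0 => w /= [] -> /esym/eqP.
  by rewrite eq_sym (negbTE ij).
Qed.

(** On each fibre of [X] the integrand is constant. The domain [D] is kept general so that taking a
    fibre of a second variable for [D] produces joint probabilities. *)
Lemma ge0_integral_natfun P (X : {RV P >-> nat}) (D : set T) f :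
  measurable D -> (forall k, (0 <= f k)%R) ->
  \int[P]_(w in D) (f (X w))%:E =
  \sum_(k <oo) (f k)%:E * P (D `&` X @^-1` [set k]).
Proof.
move=> mD f0; rewrite integral_mkcond (ge0_integral_fibers X); first last.
- by apply/(measurable_restrictT _ _).1 => //; exact: measurable_natfun.
- by move=> w; apply: erestrict_ge0 => ? _; rewrite lee_fin.
apply: eq_eseriesr => k _; rewrite -integral_mkcondl.
rewrite -integral_cst; last first.
  by apply: measurableI => //; exact: measurable_preimage_nat.
by apply: eq_integral => w /set_mem[] _ /= ->.
Qed.

(** Splitting along the fibres of [X] freezes the factor [f (X w)]; splitting further along those of
    [Y] leaves joint point probabilities, which factor by hypothesis. *)
Lemma integral_product_indep P (X Y : {RV P >-> nat}) f g :
  (forall i, (0 <= f i)%R) -> (forall j, (0 <= g j)%R) ->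
  (forall i j, P (X @^-1` [set i] `&` Y @^-1` [set j]) =
               P (X @^-1` [set i]) * P (Y @^-1` [set j])) ->
  \int[P]_w (g (Y w))%:E \is a fin_num ->
  \int[P]_w (f (X w) * g (Y w))%:E =
  (\int[P]_w (f (X w))%:E) * \int[P]_w (g (Y w))%:E.
Proof.
move=> f0 g0 XY gYfin; have mX i := measurable_preimage_nat X [set i].
have fibY i : \int[P]_(w in X @^-1` [set i]) (f (X w) * g (Y w))%:E =
    ((f i)%:E * P (X @^-1` [set i])) * \int[P]_w (g (Y w))%:E.
  transitivity (\int[P]_(w in X @^-1` [set i]) ((f i)%:E * (g (Y w))%:E)).
    by apply: eq_integral => w /set_mem /= ->; rewrite EFinM.
  rewrite ge0_integralZl_EFin//; last 2 first.
  - by move=> w _; rewrite lee_fin.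
  - exact: measurable_natfun.
  rewrite ge0_integral_natfun// (@ge0_integral_natfun _ Y setT)// -muleA.
  (* [nneseriesZl] moves only a real constant out of a series, so the probability is replaced by its
     finite value; finiteness of the integral of [g (Y w)] serves the same purpose below. *)
  congr (_ * _); have [p Pp] : exists p, P (X @^-1` [set i]) = p%:E.
    by exists (fine (P (X @^-1` [set i]))); rewrite fineK// fin_num_measure.
  rewrite Pp -nneseriesZl; last by move=> j _; rewrite mule_ge0 ?lee_fin.
  by apply: eq_eseriesr => j _; rewrite setTI XY Pp muleCA.
rewrite (ge0_integral_fibers X); last 2 first.
- by move=> w; rewrite lee_fin mulr_ge0.
- apply/measurable_EFinP; apply: measurable_funM.
  - by apply/measurable_EFinP; exact: measurable_natfun.
  - by apply/measurable_EFinP; exact: measurable_natfun.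
rewrite (eq_eseriesr (fun i _ => fibY i)).
rewrite -(fineK gYfin) (@ge0_integral_natfun _ X setT)// muleC -nneseriesZl.
  by apply: eq_eseriesr => i _; rewrite setTI muleC.
by move=> i _; rewrite mule_ge0 ?lee_fin.
Qed.
End nat_valued.

(** * Poisson weights and the first two Poisson moments *)

Lemma poisson_pmf_gt0 (R : realType) (rate : R) k : 0 < poisson_pmf rate k.
Proof.
(* For a [rate] that is not positive, [poisson_pmf] takes a positive default value. *)
rewrite /poisson_pmf; case: ifPn => // rate0.
by rewrite !mulr_gt0 ?exprn_gt0 ?invr_gt0 ?expR_gt0// ltr0n fact_gt0.
Qed.

Lemma poisson_pmfS (R : realType) (rate : R) k : 0 < rate ->
  k.+1%:R * poisson_pmf rate k.+1 = rate * poisson_pmf rate k.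
Proof.
move=> rate0; rewrite /poisson_pmf rate0 factS natrM exprS; field.
by rewrite addrC natr1 !pnatr_eq0 -lt0n fact_gt0.
Qed.

Section poisson_moments.
Context (R : realType) (rate : R).
Hypothesis rate_gt0 : 0 < rate.
Local Open Scope ereal_scope.

Lemma poisson_law1 k : poisson_law rate [set k] = (poisson_pmf rate k)%:E.
Proof.
by rewrite /poisson_law /poisson_prob rate_gt0 esum_set1// lee_fin poisson_pmf_ge0.
Qed.

Lemma nneseries_poisson_pmf : \sum_(k <oo) (poisson_pmf rate k)%:E = 1.
Proof.
rewrite nneseries_esumT; last by move=> k; rewrite lee_fin poisson_pmf_ge0.
by rewrite -(probability_setT (poisson_prob rate 0)) /= /poisson_prob rate_gt0.
Qed.

(** The term at 0 vanishes; after a shift of the index, [poisson_pmfS] trades the factor [k.+1] for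
    [rate]. As an identity between extended reals it needs no summability of [h]. *)
Lemma poisson_stein (h : nat -> R) : (forall k, (0 <= h k)%R) ->
  \sum_(k <oo) (k%:R * h k)%:E * (poisson_pmf rate k)%:E =
  rate%:E * \sum_(k <oo) (h k.+1)%:E * (poisson_pmf rate k)%:E.
Proof.
move=> h0; rewrite nneseries_recl//; last first.
  by move=> k _; rewrite -EFinM lee_fin !mulr_ge0 ?poisson_pmf_ge0.
rewrite mul0r mul0e add0e -[1%N]add0n -nneseries_addn; last first.
  by move=> k; rewrite -EFinM lee_fin !mulr_ge0 ?poisson_pmf_ge0.
rewrite -nneseriesZl; last first.
  by move=> k _; rewrite -EFinM lee_fin mulr_ge0 ?poisson_pmf_ge0.
apply: eq_eseriesr => k _; rewrite !addn1 -!EFinM; congr EFin.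
by rewrite mulrAC poisson_pmfS// mulrAC mulrA.
Qed.

Lemma poisson_mean : \sum_(k <oo) k%:R%:E * (poisson_pmf rate k)%:E = rate%:E.
Proof.
have := @poisson_stein (fun=> 1%R) (fun=> ler01).
under eq_eseriesr do rewrite mulr1.
by under [in RHS]eq_eseriesr do rewrite mul1e; rewrite nneseries_poisson_pmf mule1.
Qed.

Lemma poisson_second_moment :
  \sum_(k <oo) (k%:R * k%:R)%:E * (poisson_pmf rate k)%:E =
  (rate * rate + rate)%:E.
Proof.
(* With [h] the identity, the right side becomes [rate] times the mean of [k + 1]. *)
rewrite (@poisson_stein (fun k => k%:R)%R)//.
under eq_eseriesr do rewrite -natr1 EFinD muleDl// mul1e.
rewrite nneseriesD; last 2 first.
- by move=> k _ _; rewrite -EFinM lee_fin mulr_ge0 ?poisson_pmf_ge0.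
- by move=> k _ _; rewrite lee_fin poisson_pmf_ge0.
by rewrite poisson_mean nneseries_poisson_pmf -EFinD -EFinM mulrDr mulr1.
Qed.

End poisson_moments.

(** * Mean, variance and Markov bound for the weighted sum *)

Lemma ge0_integral_linear (d : measure_display) (T : measurableType d)
    (R : realType) (P : {measure set T -> \bar R}) (I : finType)
    (c x : I -> R) (g : I -> T -> R) :
  (forall i, 0 <= c i) -> (forall i w, 0 <= g i w) ->
  (forall i, measurable_fun setT (g i)) ->
  (forall i, (\int[P]_w (g i w)%:E = (x i)%:E)%E) ->
  (\int[P]_w (\sum_i c i * g i w)%:E = (\sum_i c i * x i)%:E)%E.
Proof.
move=> c0 g0 mg gx; under eq_integral do rewrite -sumEFin.
rewrite ge0_integral_sum//; last 2 first.
- by move=> i; apply/measurable_EFinP; exact: measurable_funM.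
- by move=> i w _; rewrite lee_fin mulr_ge0.
rewrite -sumEFin; apply: eq_bigr => i _; under eq_integral do rewrite EFinM.
rewrite ge0_integralZl_EFin ?gx//; first by move=> w _; rewrite lee_fin.
exact/measurable_EFinP.
Qed.

Section weighted_sum_moments.
Context (R : realType) (d : measure_display) (T : measurableType d).
Context (P : probability T R) (K : nat) (b : 'I_K -> nat) (nu : 'I_K -> R).
Context (A : 'I_K -> {RV P >-> nat}).
Hypothesis nu_gt0 : forall r, 0 < nu r.
Hypothesis A_poisson : forall r (U : set nat),
  distribution P (A r) U = poisson_law (nu r) U.
Hypothesis A_indep : mutually_independent A.

Let A_pmf r k : P (A r @^-1` [set k]) = (poisson_pmf (nu r) k)%:E.
Proof. by rewrite -poisson_law1// -A_poisson. Qed.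

Let mA r : measurable_fun setT (fun w => (A r w)%:R : R).
Proof. by apply/measurable_EFinP; exact: measurable_natfun. Qed.

Let integral_A r : (\int[P]_w ((A r w)%:R : R)%:E = (nu r)%:E)%E.
Proof.
rewrite (@ge0_integral_natfun _ _ _ P (A r) setT (fun k => k%:R))//.
rewrite -poisson_mean//; apply: eq_eseriesr => k _.
by rewrite setTI A_pmf.
Qed.

(** The term [(r == s)%:R * nu r] is the covariance, so that one formula covers both the diagonal
    and the independent pairs. *)
Let integral_AA r s : (\int[P]_w ((A r w)%:R * (A s w)%:R : R)%:E =
  (nu r * nu s + (r == s)%:R * nu r)%:E)%E.
Proof.
have [<-|rs] := eqVneq r s.
  rewrite (@ge0_integral_natfun _ _ _ P (A r) setT (fun k => k%:R * k%:R))//.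
  rewrite mul1r -poisson_second_moment//; apply: eq_eseriesr => k _.
  by rewrite setTI A_pmf.
rewrite (@integral_product_indep _ _ _ P (A r) (A s) (fun k => k%:R)
  (fun k => k%:R))//; last by rewrite integral_A.
  by rewrite !integral_A mul0r addr0.
(* Independence is stated for families of events, so the two point events are packed into one family
   [B] and the index set is taken to be the pair [r], [s]. *)
move=> i j; pose B u := if u == r then [set i] else [set j].
have Br : B r = [set i] by rewrite /B eqxx.
have Bs : B s = [set j] by rewrite /B eq_sym (negbTE rs).
have := @A_indep [set r; s]%SET B (fun _ _ => I).
rewrite big_setU1/= ?inE// big_set1 Br Bs => <-.
congr (P _); apply/seteqP; split => w /=.
  by move=> [Ai Aj] u /=; rewrite !inE => /orP[]/eqP ->; rewrite ?Br ?Bs.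
move=> AB; split; [have := AB r | have := AB s];
  by rewrite /= !inE eqxx ?orbT ?Br ?Bs; apply.
Qed.

Local Notation S := (weighted_sum b A).

Lemma weighted_sum_ge0 w : 0 <= S w.
Proof. by apply: sumr_ge0 => r _; rewrite mulr_ge0. Qed.

Lemma measurable_weighted_sum : measurable_fun setT S.
Proof. by apply: measurable_sum => r; exact: measurable_funM. Qed.

Lemma weighted_sum_mean : ('E_P[S] = (mu b nu)%:E)%E.
Proof. by rewrite unlock (ge0_integral_linear _ _ _ integral_A). Qed.

Lemma weighted_sum_second_moment :
  ('E_P[S * S] = (mu b nu ^+ 2 + sigma2 b nu)%:E)%E.
Proof.
(* The square is expanded over pairs of indices, which makes it a nonnegative linear combination of
   the products handled by [integral_AA]. *)
rewrite unlock; pose c (p : 'I_K * 'I_K) : R := (b p.1)%:R * (b p.2)%:R.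
have SS w : (S * S) w = \sum_p c p * ((A p.1 w)%:R * (A p.2 w)%:R).
  rewrite /= -[LHS]/(S w * S w) /weighted_sum big_distrlr/= pair_bigA/=.
  by apply: eq_bigr => p _; rewrite /c mulrACA.
under eq_integral do rewrite SS.
rewrite (@ge0_integral_linear _ _ _ P _ c
  (fun p => nu p.1 * nu p.2 + (p.1 == p.2)%:R * nu p.1)); first last.
- by move=> p; exact: integral_AA.
- by move=> p; exact: measurable_funM.
- by move=> p w; rewrite mulr_ge0.
- by move=> p; rewrite mulr_ge0.
congr EFin; under eq_bigr do rewrite mulrDr.
rewrite big_split/=; congr (_ + _).
  rewrite expr2 /mu big_distrlr/= pair_bigA/=.
  by apply: eq_bigr => p _; rewrite /c mulrACA.
(* Only the diagonal pairs survive in the covariance part, and they add up to [sigma2]. *)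
rewrite -(pair_bigA _ (fun r s => c (r, s) * ((r == s)%:R * nu r)))/=.
apply: eq_bigr => r _; rewrite (bigD1 r)//= eqxx mul1r big1 ?addr0// => s sr.
by rewrite eq_sym (negbTE sr) mul0r mulr0.
Qed.

(** [covarianceE] asks for integrability, which for a nonnegative function follows from a finite
    expectation. *)
Let Lfun1 (X : T -> R) (x : R) : measurable_fun setT X ->
  (forall w, 0 <= X w) -> ('E_P[X] = x%:E)%E -> X \in Lfun P 1.
Proof.
move=> mX X0 EX; apply/Lfun1_integrable/integrableP; split.
  exact/measurable_EFinP.
under eq_integral do rewrite /= ger0_norm ?X0//.
by move: EX; rewrite unlock => ->; rewrite ltry.
Qed.

Lemma weighted_sum_variance : ('V_P[S] = (sigma2 b nu)%:E)%E.
Proof.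
rewrite /variance covarianceE; first last.
- apply: (Lfun1 _ _ weighted_sum_second_moment).
    exact: measurable_funM measurable_weighted_sum measurable_weighted_sum.
  by move=> w; rewrite mulr_ge0 ?weighted_sum_ge0.
- exact: (Lfun1 measurable_weighted_sum weighted_sum_ge0 weighted_sum_mean).
- exact: (Lfun1 measurable_weighted_sum weighted_sum_ge0 weighted_sum_mean).
rewrite weighted_sum_second_moment weighted_sum_mean -EFinM -EFinB.
by rewrite addrAC expr2 subrr add0r.
Qed.

Lemma weighted_sum_markov (a t : R) : 0 <= a -> 0 < t ->
  fine (P [set w | t <= a * S w]) <= a * mu b nu / t.
Proof.
move=> a0 t0; have mS := measurable_weighted_sum.
have maS : measurable_fun setT (fun w => a * S w) by exact: measurable_funM.
(* With the identity as comparison function this is Markov's inequality. *)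
have := @le_integral_comp_abse _ _ _ P setT measurableT
  (EFin \o (fun w => a * S w)) t id (@measurable_id _ _ _)
  (fun _ => id) (fun x y _ _ => id).
move=> /(_ ((measurable_EFinP _ _).2 maS) t0).
rewrite setTI (_ : [set _ | _] = [set w | (t <= a * S w)%R]); last first.
  by apply/seteqP; split => w /=; rewrite lee_fin ger0_norm ?mulr_ge0 ?weighted_sum_ge0.
have -> : (\int[P]_w `|(EFin \o (fun w => a * S w)%R) w| = (a * mu b nu)%:E)%E.
  under eq_integral do rewrite /= ger0_norm ?mulr_ge0 ?weighted_sum_ge0// EFinM.
  rewrite ge0_integralZl_EFin//; first last.
  - exact/measurable_EFinP.
  - by move=> w _; rewrite lee_fin weighted_sum_ge0.
  by rewrite EFinM -weighted_sum_mean unlock.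
rewrite ler_pdivlMr// -lee_fin [(fine _ * t)%:E]EFinM fineK 1?muleC// fin_num_measure//.
rewrite -[X in measurable X]setTI (_ : [set _ | _] = (fun w => a * S w) @^-1` `[t, +oo[).
  exact: maS.
by apply/seteqP; split => w /=; rewrite in_itv/= andbT.
Qed.

End weighted_sum_moments.

(** * Estimates for [alphastar], the Poisson tail and the two constants *)

Lemma alphastar_ge0 (R : realType) (K : nat) (b : 'I_K -> nat)
    (nu : 'I_K -> R) :
  (forall r, 0 <= nu r) -> 0 <= alphastar b nu.
Proof.
(* By contraposition: a negative summand at [r] forces [beta * b r <= 1], so [r.+1] enters the
   maximum that defines [rstar]. *)
move=> nu0; apply: sumr_ge0 => r; apply: contraLR => /=.
rewrite -ltNge -leqNgt => neg.
rewrite /rstar; apply: (@leq_bigmax_cond _ _ (fun s : 'I_K => s.+1) r).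
rewrite leNgt; apply/negP => b1; move: neg; apply/negP; rewrite -leNgt.
apply: mulr_ge0; last first.
  by rewrite !mulr_ge0 ?invr_ge0// sumr_ge0// => s _; rewrite mulr_ge0.
(* Since [beta * b r] exceeds the integer 1, its ceiling is at least 2. *)
rewrite subr_ge0 -[2]/(2%:~R) ler_int -[2]/(1 + 1 : int) lez1D.
by rewrite ceil_gt_int.
Qed.

Lemma le_poisson_tail (R : realType) (rate : R) (y : nat) : 0 < rate ->
  poisson_pmf rate y <= fine (poisson_law rate [set k | (y <= k)%N]).
Proof.
move=> rate0; rewrite -lee_fin fineK; last first.
  exact: (fin_num_measure (poisson_prob rate 0)).
rewrite -poisson_law1//; apply: (le_measure (poisson_prob rate 0)).
- by rewrite inE.
- by rewrite inE.
- by move=> k /= ->.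
Qed.

Lemma poisson_pmf_le1 (R : realType) (rate : R) (k : nat) : 0 < rate ->
  poisson_pmf rate k <= 1.
Proof.
move=> rate0; rewrite -lee_fin -poisson_law1//.
exact: (probability_le1 (poisson_prob rate 0)).
Qed.

(** Two fractions with numerator [2 * lam] are compared through their denominators. Since [lam] is
    at least 1, its floor is positive, and so is the minimum, as inverting the inequality
    requires. *)
Lemma Cminus_ge (R : realType) (y : nat) (lam : R) : 1 <= lam ->
  2 / poisson_pmf lam y.-1 <= Cminus y lam.
Proof.
move=> lam1; have lam0 : 0 < lam by exact: lt_le_trans lam1.
have p0 := poisson_pmf_gt0 lam y.-1.
have fl0 : 0 < (Num.floor lam)%:~R :> R.
  by rewrite ltr0z gtz0_ge1 floor_ge_int.
have -> : 2 / poisson_pmf lam y.-1 = 2 * lam / (lam * poisson_pmf lam y.-1).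
  by field; rewrite !gt_eqF.
rewrite ler_wpM2l ?mulr_ge0 ?(ltW lam0)// lef_pV2 ?posrE ?mulr_gt0//.
  by rewrite ge_min ler_pM2r// floor_le orbT.
by rewrite lt_min poisson_pmf_gt0 mulr_gt0.
Qed.

Lemma Cplus_ge0 (R : realType) (y : nat) (lam : R) : 0 <= lam ->
  0 <= Cplus y lam.
Proof.
by move=> lam0; rewrite divr_ge0 ?mulr_ge0 ?poisson_pmf_ge0// addr_ge0.
Qed.

Theorem theorem2p1 (R : realType) (d : measure_display) (T : measurableType d)
    (P : probability T R) (K : nat) (b : 'I_K -> nat) (nu : 'I_K -> R)
    (A : 'I_K -> {RV P >-> nat}) (n m : nat)
    (K_ge1 : (1 <= K)%N)
    (b_gt0 : forall r : 'I_K, (0 < b r)%N)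
    (b_incr : forall r s : 'I_K, (r < s)%N -> (b r < b s)%N)
    (nu_gt0 : forall r : 'I_K, 0 < nu r)
    (A_poisson : forall (r : 'I_K) (U : set nat),
       distribution P (A r) U = poisson_law (nu r) U)
    (A_indep : mutually_independent A)
    (lambda_ge1 : 1 <= lambda b nu)
    (n_gt0 : (0 < n)%N) (m_gt0 : (0 < m)%N) (nm_coprime : coprime n m)
    (beta_rational : beta b nu = n%:R / m%:R) :
  [/\ ('E_P[weighted_sum b A] = (mu b nu)%:E)%E,
      ('V_P[weighted_sum b A] = (sigma2 b nu)%:E)%E &
      forall y : nat, lambda b nu + 1 < y%:R ->
        `| fine (P [set w | y%:R <= beta b nu * weighted_sum b A w])
           / fine (poisson_law (lambda b nu) [set k | (y <= k)%N]) - 1 |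
        <= (1 + alphastar b nu) * Cplus y (lambda b nu)
           + (1 + alphastar b nu) * Cminus y (lambda b nu)
           + alphastar b nu].
Proof.
have lam0 : 0 < lambda b nu := lt_le_trans ltr01 lambda_ge1.
split; [exact: weighted_sum_mean | exact: weighted_sum_variance | ].
(* The value [y = 0] contradicts [lam_y]; otherwise [y = k.+1] and [y.-1] is [k]. *)
move=> [|k] lam_y.
  by move: lam_y; rewrite ltNge addr_ge0// ltW.
set N := fine (P _); set Q := fine (poisson_law _ _).
set p := poisson_pmf (lambda b nu) k.
have p0 : 0 < p := poisson_pmf_gt0 _ _.
have p1 : p <= 1 by exact: poisson_pmf_le1.
have N0 : 0 <= N by rewrite fine_ge0.
have N_le : N <= lambda b nu / k.+1%:R.
  (* [beta * mu] is [lambda] by definition, and the fraction [n / m] shows that [beta] is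
     nonnegative. *)
  by apply: weighted_sum_markov => //; rewrite beta_rational divr_ge0.
have Q_ge : lambda b nu / k.+1%:R * p <= Q.
  apply: le_trans (le_poisson_tail k.+1 lam0).
  by rewrite mulrAC ler_pdivrMr// [leRHS]mulrC poisson_pmfS.
have Q0 : 0 < Q by apply: lt_le_trans Q_ge; rewrite mulr_gt0// divr_gt0.
(* The common factor [lambda / y] of the two bounds cancels. *)
have NQ : N / Q <= p^-1.
  rewrite ler_pdivrMr// mulrC ler_pdivlMr//.
  by apply: le_trans Q_ge; rewrite ler_pM2r.
have NQ0 : 0 <= N / Q by rewrite divr_ge0// ltW.
have ip1 : 1 <= p^-1 by rewrite invf_ge1.
have a0 : 0 <= alphastar b nu by apply: alphastar_ge0 => r; exact: ltW.
have := Cminus_ge k.+1 lambda_ge1; rewrite -/p => Cm.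
have Cp := Cplus_ge0 k.+1 (ltW lam0).
have Cm0 : 0 <= Cminus k.+1 (lambda b nu).
  by apply: le_trans Cm; rewrite divr_ge0// ltW.
have aCp : 0 <= (1 + alphastar b nu) * Cplus k.+1 (lambda b nu).
  by rewrite mulr_ge0// addr_ge0.
(* Once [(1 + alphastar) * Cminus] is expanded, this product is an atom for [lra], so its sign is
   supplied. *)
have aCm : 0 <= alphastar b nu * Cminus k.+1 (lambda b nu) by rewrite mulr_ge0.
(* The ratio minus 1 lies between [-1] and [p^-1 - 1], while the right side is at least [2 / p],
   hence at least 2. *)
rewrite ler_norml; apply/andP; split; lra.
Qed.
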